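(* For every recursive Eulerian triangulation $G$ on $n\geq 9$ vertices, $\iota(G) < 13n/42$.
   Context: Recursive Eulerian triangulations are defined recursively: a triangle is a recursive Eulerian triangulation; and if $G'$ is a recursive Eulerian triangulation (as a plane graph) with a face bounded by the triangle $xyz$, then the plane graph obtained by drawing a new triangle $abc$ inside this face and adding the edges $ay, az, bx, bz, cx, cy$ (so that the subgraph induced by $\{x,y,z,a,b,c\}$ is an octahedron) is a recursive Eulerian triangulation. $\iota(G)$ denotes the minimum cardinality of a set $S\subseteq V(G)$ that is independent (no two vertices of $S$ adjacent) and dominating (every vertex of $G$ is in $S$ or adjacent to a vertex of $S$). *)

(* Defs.v *)
From mathcomp Require Import all_boot all_order all_algebra.

Set Implicit Arguments.
Unset Strict Implicit.
Unset Printing Implicit Defensive.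

Record sgraph := SGraph {
  vertex :> finType;
  adj : rel vertex;
  adj_sym : symmetric adj;
  adj_irrefl : irreflexive adj
}.

Definition edges (G : sgraph) : {set {set G}} :=
  [set [set p.1; p.2] | p : G * G & adj p.1 p.2].

Section PlaneTriangulations.
Variable T : finType.

Definition tri_edges (x y z : T) : {set {set T}} :=
  [set [set x; y]; [set y; z]; [set x; z]].

(* [RET_plane V E F]: a recursive Eulerian triangulation, as a plane graph,   *)
(* with vertex set V, edge set E and face list F. All faces are triangles, so *)
(* a face is recorded by its set of three boundary vertices. The unbounded    *)
(* face is a face like the others. F is a multiset because the two faces of   *)
(* the initial triangle have the same boundary. In the second constructor     *)
(* the face xyz is replaced by the seven faces into which the new triangle    *)
(* abc and the edges ay, az, bx, bz, cx, cy divide it.                        *)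
Inductive RET_plane : {set T} -> {set {set T}} -> seq {set T} -> Prop :=
| RET_triangle (x y z : T) :
    uniq [:: x; y; z] ->
    RET_plane [set x; y; z] (tri_edges x y z)
      [:: [set x; y; z]; [set x; y; z]]
| RET_octahedron (V : {set T}) (E : {set {set T}}) (F : seq {set T})
    (x y z a b c : T) :
    RET_plane V E F ->
    uniq [:: x; y; z] -> [set x; y; z] \in F ->
    uniq [:: a; b; c] -> a \notin V -> b \notin V -> c \notin V ->
    RET_plane (V :|: [set a; b; c])
      (E :|: tri_edges a b c
         :|: [set [set a; y]; [set a; z]; [set b; x];
                  [set b; z]; [set c; x]; [set c; y]])
      ([:: [set a; b; c];
           [set a; y; z]; [set b; x; z]; [set c; x; y];
           [set a; b; z]; [set a; c; y]; [set b; c; x]]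
         ++ rem [set x; y; z] F).

End PlaneTriangulations.

Definition recursive_Eulerian_triangulation (G : sgraph) : Prop :=
  exists F : seq {set G}, RET_plane [set: G] (edges G) F.

Section IndependentDomination.
Variable G : sgraph.

Definition independent (S : {set G}) : bool :=
  [forall u in S, forall v in S, ~~ adj u v].

Definition dominating (S : {set G}) : bool :=
  [forall v, (v \in S) || [exists u in S, adj v u]].

Definition has_ids_of_card (k : nat) : bool :=
  [exists S : {set G}, [&& independent S, dominating S & #|S| == k]].

Lemma ex_ids_card : exists k, has_ids_of_card k.
Proof.
have i0 : independent set0 by apply/forall_inP => u; rewrite inE.
have [S /maxsetP[iS maxS] _] := maxset_exists i0.
exists #|S|; apply/existsP; exists S; rewrite iS eqxx andbT /=.
apply/forallP => v; apply/orP; case: (boolP (v \in S)) => [|vS]; first by left.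
right; apply/contraT => /exists_inPn nadj; case/negP: vS.
have iU : independent (v |: S).
  apply/forall_inP => u uU; apply/forall_inP => w.
  move: uU; rewrite !inE => /predU1P[->|uS] /predU1P[->|wS].
  - by rewrite adj_irrefl.
  - exact: nadj.
  - by rewrite adj_sym nadj.
  - by move/forall_inP: iS => /(_ _ uS) /forall_inP; apply.
by rewrite -(maxS _ iU (subsetUr _ _)) !inE eqxx.
Qed.

Definition indep_dom_number : nat := ex_minn ex_ids_card.

End IndependentDomination.

(* Main.v *)
Require Import Defs.
From mathcomp Require Import all_boot all_order all_algebra.
From mathcomp Require Import zify.

Set Implicit Arguments.
Unset Strict Implicit.
Unset Printing Implicit Defensive.

(** A recursive Eulerian triangulation is an octahedron each of whose eight
    faces carries a tree of inserted octahedra. Six independent dominating sets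
    are built at once. For each colour [i] of the 3-colouring, one starts from
    each of the two opposite vertices [x i], [p i] of colour [i] in the root
    octahedron; the other one is omitted as soon as one of its faces is refined,
    because the refinement can then be made to dominate it. On every face, the
    six sets restrict to three that contain the corner of colour 0, 1, 2
    respectively, and three that avoid the face. An insertion in the face
    permutes these six types on each new face, so the sizes add up over the tree
    without loss. A set containing the corner [x i] takes from the inserted
    triangle either nothing or [p i], the latter only if all faces at [p i]
    remain unrefined; a set avoiding the face takes exactly one vertex.
    A triangle with [c] refined faces is thus hit at most [6 - d] times, where
    the number [d] of its vertices lying on a refined face satisfies
    [3 c <= 7 d]. Summing, the six sets have total size less than
    [6 * 13 n / 42]. *)

(** * Trees of inserted octahedra *)

Section OctahedronTrees.
Variable T : finType.
Implicit Types (x p : 'I_3 -> T) (q : bool -> 'I_3 -> T) (s : {set 'I_3}).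
Implicit Types (f e : {set T}) (u v w : T).

(* [Node p ch], filling a face with corners [x], inserts the triangle [p], where
   [p i] is the vertex not adjacent to [x i]. The face indexed by [s] has corner
   [p i] if [i \in s] and [x i] otherwise; [set0] is the filled face itself. *)
Inductive otree :=
| Hole
| Node of ('I_3 -> T) & ({set 'I_3} -> otree).
Implicit Types (t : otree) (ch : {set 'I_3} -> otree).

Definition filled t := if t is Node _ _ then true else false.

Definition octa x p (b : bool) := if b then p else x.

Definition corner q s (i : 'I_3) := q (i \in s) i.

(** A multiplicity, so that a bound by 1 on a sum of such counts makes triangles injective and
    pairwise disjoint at once. *)
Definition occ x v : nat := \sum_i (x i == v).

(** The edges of [x] are left out: they belong to the stage that created them, so every edge of a
    tree has an inner end. *)
Definition octa_edges x p : {set {set T}} :=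
  [set [set p k.1.1; octa x p k.2 k.1.2] | k : 'I_3 * 'I_3 * bool & k.1.1 != k.1.2].

Definition octa_faces x p f : nat :=
  \sum_(s | s != set0) ([set corner (octa x p) s i | i : 'I_3] == f).

Fixpoint tsize t : nat :=
  if t is Node p ch then (\sum_s tsize (ch s)).+1 else 0.

Fixpoint tocc t v : nat :=
  if t is Node p ch then occ p v + \sum_s tocc (ch s) v else 0.

Fixpoint tedges x t : {set {set T}} :=
  if t is Node p ch then
    octa_edges x p :|: \bigcup_s tedges (corner (octa x p) s) (ch s)
  else set0.

Fixpoint tholes x t f : nat :=
  if t is Node p ch then
    \sum_(s | s != set0) tholes (corner (octa x p) s) (ch s) f
  else [set x i | i : 'I_3] == f.

(** The filled face itself cannot be filled again from within. Its slot [set0] serves only at the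
    root, for the other side of the initial triangle. *)
Fixpoint wf t : Prop :=
  if t is Node p ch then ~~ filled (ch set0) /\ forall s, wf (ch s) else True.

(* The part inside a filled face of one of the six sets: [sel false t i] is used
   when the set contains the corner of colour [i], and [sel true t i] when it
   contains no corner, in which case it must dominate the corner of colour [i].
   The shift from [i] to [ordS i] makes [p (ordS i)] dominate that corner, and
   makes the six types seen on each subface a permutation of those of the face. *)
Fixpoint sel (z : bool) t (i : 'I_3) : {set T} :=
  if t is Node p ch then
    let j := if z then ordS i else i in
    (if z || ~~ [exists s : {set 'I_3}, (j \in s) && filled (ch s)] then [set p j] else set0)
      :|: \bigcup_(s : {set 'I_3}) sel (z (+) (j \in s)) (ch s) j
  else set0.

(** * Insertion of an octahedron into a tree *)

Definition upd ch s t s' := if s' == s then t else ch s'.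

Lemma sum_upd (F : {set 'I_3} -> otree -> nat) (P : pred {set 'I_3}) ch s t k l :
  P s -> F s t + k = F s (ch s) + l ->
  \sum_(s' | P s') F s' (upd ch s t s') + k = \sum_(s' | P s') F s' (ch s') + l.
Proof.
move=> Ps eqF; rewrite (bigD1 s) //= [in RHS](bigD1 s) //= /upd eqxx.
rewrite (eq_bigr (fun s' => F s' (ch s'))); last first.
  by move=> s' /andP[_ /negPf ->].
by rewrite addnAC eqF addnAC.
Qed.

Lemma occ_gt0 x v : reflect (exists i, v = x i) (0 < occ x v).
Proof.
rewrite lt0n sum_nat_eq0; apply: (iffP idP).
  by rewrite negb_forall => /existsP[i]; rewrite /= eqb0 negbK => /eqP <-; exists i.
by case=> i ->; rewrite negb_forall; apply/existsP; exists i; rewrite /= eqxx.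
Qed.

Lemma occ_id_gt0 x i : 0 < occ x (x i).
Proof. by apply/occ_gt0; exists i. Qed.

Lemma occ_le1_inj x : (forall v, occ x v <= 1) -> injective x.
Proof.
move=> le1 i j eqx; apply/eqP; apply: contraT => nij.
by move: (le1 (x j)); rewrite /occ (bigD1 i) //= (bigD1 j) 1?eq_sym //= eqx eqxx.
Qed.

Lemma inj_occ_le1 x v : injective x -> occ x v <= 1.
Proof.
move=> injx; case: (posnP (occ x v)) => [-> //|/occ_gt0[i ->]].
rewrite /occ (bigD1 i) //= eqxx big1 // => j nji.
by rewrite (inj_eq injx) (negPf nji).
Qed.

Lemma octa_edgesP x p e :
  reflect (exists i j b, i != j /\ e = [set p i; octa x p b j]) (e \in octa_edges x p).
Proof.
apply: (iffP imsetP) => [[[[i j] b]]|[i [j [b [ij ->]]]]].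
  by rewrite inE => /= ij ->; exists i, j, b.
by exists (i, j, b); rewrite ?inE.
Qed.

(** The labelling [y] of the hole is dictated by the path to it and comes before [p], so that the
    new triangle can be labelled to match. It is injective because every subface takes its corners
    from two disjoint triangles. *)
Lemma tree_insert t x f :
  wf t -> (forall v, occ x v + tocc t v <= 1) -> 0 < tholes x t f ->
  exists y, [/\ [set y i | i : 'I_3] = f, injective y &
    forall p, exists t',
      [/\ forall v, tocc t' v = tocc t v + occ p v,
          tedges x t' = tedges x t :|: octa_edges y p,
          forall g, tholes x t' g + (f == g) = tholes x t g + octa_faces y p g &
          wf t']].
Proof.
elim: t x => [|p0 ch IH] x /=.
  move=> _ dis; rewrite lt0b => /eqP eqf; exists x; split=> // [|p].
    by apply: occ_le1_inj => v; move: (dis v); rewrite addn0.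
  exists (Node p (fun=> Hole)); split=> //=.
  - by move=> v; rewrite big1 ?addn0.
  - by rewrite big1_eq setU0 set0U.
  - by move=> g; rewrite -eqf addnC.
case=> ch0 wfch dis; rewrite lt0n sum_nat_eq0 negb_forall => /existsP[s].
rewrite negb_imply -lt0n => /andP[s0 holes].
case: (IH s _ (wfch s) _ holes) => [v|y [eqf injy ins]].
  have le_c : occ (corner (octa x p0) s) v <= occ x v + occ p0 v.
    rewrite -big_split /=; apply: leq_sum => i _; rewrite /corner /octa.
    by case: (i \in s); rewrite ?leq_addl ?leq_addr.
  by move: (dis v); rewrite (bigD1 s) //=; lia.
exists y; split=> // p; have [t' [t'o t'e t'h t'wf]] := ins p.
exists (Node p0 (upd ch s t')); split=> /=.
- move=> v; rewrite -addnA -[X in occ p0 v + X]addn0; congr (_ + _).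
  by apply: (@sum_upd (fun _ t => tocc t v)) => //=; rewrite t'o addn0.
- rewrite -setUA; congr (_ :|: _).
  rewrite (bigD1 s) //= [in RHS](bigD1 s) //= {1}/upd eqxx t'e.
  rewrite -!setUA; congr (_ :|: _); rewrite setUC; congr (_ :|: _).
  by apply: eq_bigr => s' /negPf ns; rewrite /upd ns.
- move=> g.
  exact: (@sum_upd (fun s t => tholes (corner (octa x p0) s) t g)
    (fun s => s != set0)).
- split; first by rewrite /upd eq_sym (negPf s0).
  by move=> s'; rewrite /upd; case: ifP.
Qed.


(** * Permuting the three colours *)

Section Relabel.
Variable sg : 'I_3 -> 'I_3.
Hypothesis sg_inj : injective sg.

Lemma imset_relabel x : [set x (sg i) | i : 'I_3] = [set x i | i : 'I_3].
Proof.
apply/setP => v; apply/imsetP/imsetP => -[i _ ->]; first by exists (sg i).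
by have [sg' _ sgK] := injF_bij sg_inj; exists (sg' i); rewrite ?sgK.
Qed.

Lemma occ_relabel x v : occ (x \o sg) v = occ x v.
Proof. by rewrite /occ [RHS](reindex_inj sg_inj). Qed.

Lemma octa_edges_relabel x p : octa_edges (x \o sg) (p \o sg) = octa_edges x p.
Proof.
have [sg' sgK' sgK] := injF_bij sg_inj.
apply/setP => e; apply/octa_edgesP/octa_edgesP => -[i [j [b [ij ->]]]].
  by exists (sg i), (sg j), b; rewrite (inj_eq sg_inj); split=> //; case: b.
exists (sg' i), (sg' j), b; rewrite (inj_eq (can_inj sgK)).
by split=> //; case: b; rewrite /= !sgK.
Qed.

Lemma octa_faces_relabel x p f : octa_faces (x \o sg) (p \o sg) f = octa_faces x p f.
Proof.
have [sg' sgK' sgK] := injF_bij sg_inj.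
(* A permutation of the colours acts on the indices of faces by preimage. *)
have pre_inj : injective (fun s : {set 'I_3} => sg @^-1: s).
  move=> s1 s2 /setP eqs; apply/setP => i.
  by have := eqs (sg' i); rewrite !inE sgK.
rewrite /octa_faces (reindex_inj pre_inj) /=; apply: eq_big => s.
  by rewrite -[in RHS](inj_eq pre_inj s set0) preimset0.
move=> _; rewrite -[in RHS]imset_relabel; congr ((_ == _) : nat).
apply: eq_imset => i; rewrite /corner /octa inE.
by case: (sg i \in s).
Qed.

End Relabel.

(** * Explicit triangles, and plane triangulations as pairs of trees *)

Definition tri (a b c : T) (i : 'I_3) : T :=
  if i == 0 :> nat then a else if i == 1 :> nat then b else c.

Lemma ord3P (P : 'I_3 -> Prop) : P (inord 0) -> P (inord 1) -> P (inord 2) -> forall i, P i.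
Proof.
move=> P0 P1 P2 i; rewrite -(inord_val i).
by case: i => -[|[|[|]]].
Qed.

Lemma tri_inord a b c :
  (tri a b c (inord 0) = a) * (tri a b c (inord 1) = b) * (tri a b c (inord 2) = c).
Proof. by rewrite /tri !inordK. Qed.

Lemma imset_tri a b c : [set tri a b c i | i : 'I_3] = [set a; b; c].
Proof.
apply/setP => v; rewrite !inE; apply/imsetP/idP => [[i _ ->]|].
  by elim/ord3P: i; rewrite tri_inord eqxx ?orbT.
rewrite -orbA => /or3P[] /eqP ->.
- by exists (inord 0); rewrite ?tri_inord.
- by exists (inord 1); rewrite ?tri_inord.
- by exists (inord 2); rewrite ?tri_inord.
Qed.

Lemma tri_inj a b c : uniq [:: a; b; c] -> injective (tri a b c).
Proof.
rewrite /= !inE negb_or andbT => /andP[/andP[ab ac] bc] i j.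
have [ba ca cb] : [/\ b != a, c != a & c != b] by rewrite ![_ == a]eq_sym [c == b]eq_sym.
by elim/ord3P: i; elim/ord3P: j; rewrite !tri_inord => // /eqP;
  rewrite ?(negPf ab, negPf ac, negPf bc, negPf ba, negPf ca, negPf cb).
Qed.

Lemma occ_inj x v : injective x -> occ x v = (v \in [set x i | i : 'I_3]).
Proof.
move=> injx; have := inj_occ_le1 v injx; case: imsetP => [[i _ ->]|nv].
  by have := occ_id_gt0 x i; lia.
case: (posnP (occ x v)) => // /occ_gt0[i vi] _.
by case: nv; exists i.
Qed.

Lemma octa_edges_tri (x y z a b c : T) :
  octa_edges (tri x y z) (tri a b c)
    = tri_edges a b c :|: [set [set a; y]; [set a; z]; [set b; x];
                  [set b; z]; [set c; x]; [set c; y]].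
Proof.
apply/setP => e; apply/octa_edgesP/idP.
  case=> i [j [d [+ ->]]].
  elim/ord3P: i; elim/ord3P: j; rewrite -val_eqE /= !inordK //= => _;
  case: d; rewrite /octa !tri_inord !inE ?eqxx ?orbT //;
  by rewrite 1?[[set b; a]]setUC 1?[[set c; a]]setUC 1?[[set c; b]]setUC ?eqxx ?orbT.
have wit (i j : nat) (d : bool) : i < 3 -> j < 3 -> i != j ->
  exists i' j' d', (i' : 'I_3) != j' /\
    [set tri a b c (inord i); octa (tri x y z) (tri a b c) d (inord j)]
      = [set tri a b c i'; octa (tri x y z) (tri a b c) d' j'].
  move=> i3 j3 ij; exists (inord i), (inord j), d; split=> //.
  by rewrite -val_eqE /= !inordK.
rewrite /tri_edges !inE -!orbA => /or4P[||| /or4P[||| /or3P[||]]] /eqP ->.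
- by have := wit 0 1 true isT isT isT; rewrite /octa /= !tri_inord.
- by have := wit 1 2 true isT isT isT; rewrite /octa /= !tri_inord.
- by have := wit 0 2 true isT isT isT; rewrite /octa /= !tri_inord.
- by have := wit 0 1 false isT isT isT; rewrite /octa /= !tri_inord.
- by have := wit 0 2 false isT isT isT; rewrite /octa /= !tri_inord.
- by have := wit 1 0 false isT isT isT; rewrite /octa /= !tri_inord.
- by have := wit 1 2 false isT isT isT; rewrite /octa /= !tri_inord.
- by have := wit 2 0 false isT isT isT; rewrite /octa /= !tri_inord.
- by have := wit 2 1 false isT isT isT; rewrite /octa /= !tri_inord.
Qed.

(** Three bits per subset, so that a sum over subsets unfolds into eight explicit terms. *)
Definition mkset3 (k : bool * bool * bool) : {set 'I_3} :=
  [set i : 'I_3 | nth false [:: k.1.1; k.1.2; k.2] i].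

Lemma mkset3_bij : bijective mkset3.
Proof.
exists (fun s : {set 'I_3} => (inord 0 \in s, inord 1 \in s, inord 2 \in s)).
  by case=> -[a b] c; rewrite !inE !inordK.
move=> s; apply/setP => i; rewrite inE /=.
by elim/ord3P: i; rewrite inordK.
Qed.

Lemma octa_faces_tri (x y z a b c : T) f :
  octa_faces (tri x y z) (tri a b c) f
    = count_mem f [:: [set a; b; c];
           [set a; y; z]; [set b; x; z]; [set c; x; y];
           [set a; b; z]; [set a; c; y]; [set b; c; x]].
Proof.
rewrite /octa_faces (reindex mkset3) /=; last exact: onW_bij mkset3_bij.
have ne k : (mkset3 k != set0) = [|| k.1.1, k.1.2 | k.2].
  have -> : set0 = mkset3 (false, false, false).
    by apply/setP => i; rewrite !inE; elim/ord3P: i; rewrite inordK.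
  rewrite (inj_eq (bij_inj mkset3_bij)).
  by case: k => -[[] []] [].
have im k : [set corner (octa (tri x y z) (tri a b c)) (mkset3 k) i | i : 'I_3]
  = [set if k.1.1 then a else x; if k.1.2 then b else y; if k.2 then c else z].
  rewrite -imset_tri; apply: eq_imset => i; rewrite /corner inE.
  by elim/ord3P: i; rewrite inordK //= !tri_inord /octa; case: ifP; rewrite !tri_inord.
rewrite (eq_bigl _ _ ne) (eq_bigr _ (fun k _ => congr1 (fun A => nat_of_bool (A == f)) (im k))).
rewrite big_mkcond /=.
rewrite -(pair_bigA _ (fun k1 k2 => if [|| k1.1, k1.2 | k2] then nat_of_bool
  ([set if k1.1 then a else x; if k1.2 then b else y; if k2 then c else z] == f) else 0)) /=.
rewrite -(pair_bigA _ (fun k1 k2 => \sum_k3 if [|| k1, k2 | k3] then nat_of_bool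
  ([set if k1 then a else x; if k2 then b else y; if k3 then c else z] == f) else 0)) /=.
rewrite !big_bool /=.
have r1 : [set x; b; z] = [set b; x; z] by rewrite [[set x; b]]setUC.
have r2 : [set x; y; c] = [set c; x; y] by rewrite -setUA setUC -setUA setUC.
have r3 : [set a; y; c] = [set a; c; y] by rewrite setUAC.
have r4 : [set x; b; c] = [set b; c; x] by rewrite -setUA setUC.
by rewrite r1 r2 r3 r4; lia.
Qed.

Definition tri_edges3 x : {set {set T}} :=
  [set [set x k.1; x k.2] | k : 'I_3 * 'I_3 & k.1 != k.2].

Lemma tri_edges3E (x y z : T) : tri_edges3 (tri x y z) = tri_edges x y z.
Proof.
apply/setP => e; apply/imsetP/idP.
  case=> -[i j]; rewrite inE /= => + ->.
  elim/ord3P: i; elim/ord3P: j; rewrite -val_eqE /= !inordK //= => _;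
  rewrite !tri_inord !inE ?eqxx ?orbT //;
  by rewrite 1?[[set y; x]]setUC 1?[[set z; x]]setUC 1?[[set z; y]]setUC ?eqxx ?orbT.
rewrite /tri_edges !inE -!orbA => /or3P[] /eqP ->.
- by exists (inord 0, inord 1); rewrite ?inE ?tri_inord // -val_eqE /= !inordK.
- by exists (inord 1, inord 2); rewrite ?inE ?tri_inord // -val_eqE /= !inordK.
- by exists (inord 0, inord 2); rewrite ?inE ?tri_inord // -val_eqE /= !inordK.
Qed.

(** Each side of the initial triangle carries its own tree. The bound on face counts makes the face
    chosen by the next construction step a hole of one of them, where [tree_insert] applies. *)
Lemma RET_otree V E F :
  RET_plane V E F ->
  exists x t1 t2,
    [/\ forall v, occ x v + tocc t1 v + tocc t2 v = (v \in V),
        E = tri_edges3 x :|: tedges x t1 :|: tedges x t2,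
        forall f, count_mem f F <= tholes x t1 f + tholes x t2 f,
        wf t1 & wf t2].
Proof.
elim=> {V E F} [x y z uxyz|V E F x y z a b c _ [x0 [t1 [t2 [eqV eqE leF wf1 wf2]]]]].
  exists (tri x y z), Hole, Hole; split=> //=.
  - by move=> v; rewrite !addn0 occ_inj ?imset_tri //; apply: tri_inj.
  - by rewrite !setU0 tri_edges3E.
  - by move=> f; rewrite addn0 imset_tri.
move=> uxyz xyzF uabc aV bV cV.
(* The tree has its own order for the corners of the hole. The permutation relating it to [x], [y],
   [z] is applied to [a], [b], [c] too, so that opposite vertices still correspond. *)
have relabel y' : [set y' i | i : 'I_3] = [set x; y; z] -> injective y' ->
    exists2 p, forall v, occ p v = (v \in [set a; b; c]) &
      octa_edges y' p = octa_edges (tri x y z) (tri a b c) /\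
      octa_faces y' p =1 octa_faces (tri x y z) (tri a b c).
  move=> imy injy.
  have /fin_all_exists[sg sgP] : forall i, exists k, y' i = tri x y z k.
    move=> i; have : y' i \in [set tri x y z i | i : 'I_3].
      by rewrite imset_tri -imy imset_f.
    by case/imsetP => k _ ->; exists k.
  have sg_inj : injective sg by move=> i j eqs; apply: injy; rewrite !sgP eqs.
  exists (tri a b c \o sg) => [v|].
    by rewrite occ_relabel // occ_inj ?imset_tri //; apply: tri_inj.
  rewrite -(octa_edges_relabel sg_inj (tri x y z)); split.
    rewrite /octa_edges; apply: eq_imset => -[[i j] d] /=.
    by rewrite /octa; case: d => //=; rewrite sgP.
  move=> f; rewrite -(octa_faces_relabel sg_inj (tri x y z)).
  apply: eq_bigr => s _; congr ((_ == _) : nat); apply: eq_imset => i.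
  by rewrite /corner /octa; case: (i \in s) => //=; rewrite sgP.
have Vabc v : (v \in V) + (v \in [set a; b; c]) = (v \in V :|: [set a; b; c]).
  rewrite [in RHS]in_setU; case vV: (v \in V) => //=; rewrite !inE.
  by apply/eqP; rewrite eqSS eqb0 !negb_or -andbA; apply/and3P; split;
    apply: contraTneq vV => ->.
have : 0 < count_mem [set x; y; z] F by rewrite -has_count has_pred1.
move/leq_trans/(_ (leF _)); rewrite addn_gt0.
have countF f : count_mem f (rem [set x; y; z] F) + ([set x; y; z] == f)
    = count_mem f F.
  rewrite count_rem xyzF /=; case: eqP => [eqf|_]; last by rewrite subn0 addn0.
  by rewrite subnK // -has_count has_pred1 -eqf.
case/orP => hole.
  have [|y' [imy injy ins]] := tree_insert wf1 _ hole.
    by move=> v; have := eqV v; case: (v \in V); lia.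
  have [p occp [pE pF]] := relabel _ imy injy.
  have [t' [t'o t'e t'h t'wf]] := ins p.
  exists x0, t', t2; split=> //.
  - by move=> v; rewrite t'o occp -Vabc -eqV; lia.
  - rewrite t'e pE octa_edges_tri eqE -!setUA; congr (_ :|: (_ :|: _)).
    by rewrite setUC -!setUA.
  - move=> f; rewrite count_cat -octa_faces_tri -pF.
    by have := t'h f; have := countF f; have := leF f; lia.
have [|y' [imy injy ins]] := tree_insert wf2 _ hole.
  by move=> v; have := eqV v; case: (v \in V); lia.
have [p occp [pE pF]] := relabel _ imy injy.
have [t' [t'o t'e t'h t'wf]] := ins p.
exists x0, t1, t'; split=> //.
- by move=> v; rewrite t'o occp -Vabc -eqV; lia.
- by rewrite t'e pE octa_edges_tri eqE -!setUA.
- move=> f; rewrite count_cat -octa_faces_tri -pF.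
  by have := t'h f; have := countF f; have := leF f; lia.
Qed.

(** * Vertex counts and ends of tree edges *)

Lemma sum_occ x : \sum_v occ x v = 3.
Proof.
rewrite /occ exchange_big /= (eq_bigr (fun=> 1)) ?sum1_card ?card_ord // => i _.
rewrite (bigD1 (x i)) //= eqxx big1 // => v nv.
by rewrite eq_sym (negPf nv).
Qed.

Lemma sum_tocc t : \sum_v tocc t v = 3 * tsize t.
Proof.
elim: t => [|p ch IH] /=; first by rewrite big1.
rewrite big_split /= sum_occ exchange_big /= mulnS big_distrr /=.
by congr (_ + _); apply: eq_bigr => s _; apply: IH.
Qed.

Lemma eq_tedges x y t : x =1 y -> tedges x t = tedges y t.
Proof.
elim: t x y => [//|p ch IH] x y eqxy /=.
have eqo b : octa x p b =1 octa y p b by case: b.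
congr (_ :|: _).
  by rewrite /octa_edges; apply: eq_imset => -[[i j] b]; rewrite /= eqo.
by apply: eq_bigr => s _; apply: IH => i; rewrite /corner eqo.
Qed.

Lemma occ_corner_le q s v : occ (corner q s) v <= occ (q false) v + occ (q true) v.
Proof.
rewrite -big_split /=; apply: leq_sum => i _; rewrite /corner.
by case: (i \in s); rewrite ?leq_addl ?leq_addr.
Qed.

Lemma tedges_inner x t e : e \in tedges x t -> exists2 v, v \in e & 0 < tocc t v.
Proof.
elim: t x => [|p ch IH] x /=; first by rewrite inE.
case/setUP => [/octa_edgesP[i [j [b [_ ->]]]]|/bigcupP[s _ /IH[v ve tv]]].
  by exists (p i); rewrite ?set21 // addn_gt0 occ_id_gt0.
by exists v => //; rewrite (bigD1 s) //= addn_gt0 addn_gt0 tv orbT.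
Qed.

Lemma tedges_support x t e v : e \in tedges x t -> v \in e -> 0 < occ x v + tocc t v.
Proof.
elim: t x => [|p ch IH] x /=; first by rewrite inE.
case/setUP => [/octa_edgesP[i [j [b [_ ->]]]]|/bigcupP[s _ /IH sv] /sv {sv}].
  rewrite !inE => /orP[] /eqP ->; first by have := occ_id_gt0 p i; lia.
  by case: b => /=; [have := occ_id_gt0 p j|have := occ_id_gt0 x j]; lia.
have /= := occ_corner_le (octa x p) s v.
by rewrite (bigD1 s) //=; lia.
Qed.

(** * Total size of the six sets *)

Definition branch (z : bool) (j : 'I_3) ch : {set T} :=
  \bigcup_(s : {set 'I_3}) sel (z (+) (j \in s)) (ch s) j.

(** Of the two opposite vertices of colour [j], the set is built around [q z j]. The face [s] has
    the other one, [q (~~ z) j], as a corner exactly when [z (+) (j \in s)]. *)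
Definition droppable (z : bool) (j : 'I_3) ch : bool :=
  [exists s : {set 'I_3}, (z (+) (j \in s)) && filled (ch s)].

Lemma sel_Node z p ch i :
  sel z (Node p ch) i =
    if z then p (ordS i) |: branch true (ordS i) ch
    else (if droppable false i ch then set0 else [set p i]) :|: branch false i ch.
Proof. by case: z => //=; rewrite /droppable /=; case: existsP. Qed.

Definition tot t := \sum_i (#|sel false t i| + #|sel true t i|).

Lemma leq_card_bigcup (I : finType) (A : I -> {set T}) :
  #|\bigcup_i A i| <= \sum_i #|A i|.
Proof.
elim/big_rec2: _ => [|i n B _ IH]; first by rewrite cards0.
by apply: leq_trans (leq_card_setU _ _) _; rewrite leq_add2l.
Qed.

(** For fixed [j] and [s], the xor with [j \in s] at most swaps the two flags, so each subface sees
    each of its six types once. *)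
Lemma branch_tot ch :
  \sum_j (#|branch false j ch| + #|branch true j ch|) <= \sum_s tot (ch s).
Proof.
rewrite exchange_big /=; apply: leq_sum => j _.
apply: leq_trans (leq_add (leq_card_bigcup _) (leq_card_bigcup _)) _.
rewrite -big_split /=; apply: leq_sum => s _.
by case: (j \in s); rewrite //= addnC.
Qed.

Lemma card_family_le (A : {set {set 'I_3}}) : #|A| <= 2 ^ #|cover A|.
Proof.
rewrite -card_powerset; apply: subset_leq_card; apply/subsetP => s sA.
by rewrite inE; apply: bigcup_sup sA.
Qed.

Lemma sum_filled ch : \sum_s filled (ch s) = #|[set s | filled (ch s)]|.
Proof.
rewrite -sum1_card [RHS]big_mkcond; apply: eq_bigr => s _.
by rewrite inE; case: filled.
Qed.

Lemma droppable_new ch :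
  \sum_j droppable false j ch = #|cover [set s | filled (ch s)]|.
Proof.
rewrite -sum1_card [RHS]big_mkcond; apply: eq_bigr => j _.
suff -> : droppable false j ch = (j \in cover [set s | filled (ch s)]) by case: (j \in _).
apply/existsP/bigcupP => [[s /andP[/= js fs]]|[s]].
  by exists s; rewrite ?inE.
by rewrite inE => fs js; exists s; rewrite /= js.
Qed.

(** Let [c] subfaces be filled and let [d] new vertices lie on them. The new triangle costs at most
    [6 - d], and 7 * 6 = 39 + 3 leaves the surplus 3 for the face above. The surpluses [3 * c]
    coming from below are paid by the saving [7 * d]. *)
Lemma tot_le t : wf t -> 7 * tot t <= 39 * tsize t + 3 * filled t.
Proof.
elim: t => [_|p ch IH /= [ch0 wfch]].
  by rewrite /tot big1 // => i _; rewrite /= cards0.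
have totN : tot (Node p ch) + \sum_j droppable false j ch <=
    \sum_j (#|branch false j ch| + #|branch true j ch|) + 6.
  (* The sets avoiding the face pass to colour [ordS i]; summing over all colours undoes the
     shift. *)
  have -> : \sum_j (#|branch false j ch| + #|branch true j ch|) + 6
      = \sum_j (#|branch false j ch| + #|branch true (ordS j) ch| + 2).
    rewrite !big_split /= sum_nat_const card_ord.
    by rewrite [X in _ + X + 6 = _](reindex_inj (@ordS_inj 3)).
  rewrite /tot -big_split.
  apply: leq_sum => i _; rewrite !(sel_Node _ p) /=.
  rewrite cardsU1; case: (droppable _ _ _); rewrite ?set0U ?cardsU1;
    by do 2?case: (_ \notin _) => /=; lia.
(* Filled faces are nonempty subsets of a set of size [d], so [c] is at most 0, 1, 3, 7 for [d] = 0,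
   1, 2, 3; equality [3 * c = 7 * d] occurs at [d = 3]. *)
have card_fam : 3 * \sum_s filled (ch s) <= 7 * \sum_j droppable false j ch.
  rewrite sum_filled droppable_new; set A := [set s | _].
  have A0 : set0 \notin A by rewrite inE.
  have leA : #|A| < 2 ^ #|cover A|.
    rewrite -card_powerset; apply: proper_card; apply/properP; split.
      apply/subsetP => s sA.
      by rewrite inE; apply: bigcup_sup sA.
    by exists set0; rewrite // inE sub0set.
  have : #|cover A| <= 3 by have := max_card (mem (cover A)); rewrite card_ord.
  by move: leA; case: #|cover A| => [|[|[|[|]]]] //=; lia.
have sumIH : 7 * \sum_s tot (ch s) <= 39 * \sum_s tsize (ch s) + 3 * \sum_s filled (ch s).
  by rewrite !big_distrr -big_split /=; apply: leq_sum => s _; apply: IH.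
have := branch_tot ch; move: totN card_fam sumIH.
move: (\sum_s tot _) (\sum_s filled _) (\sum_s tsize _) (tot _) (\sum_j _) (\sum_j _) => *.
lia.
Qed.

Definition octa_sel (z : bool) q ch (i : 'I_3) : {set T} :=
  q z i |: ((if droppable z i ch then set0 else [set q (~~ z) i]) :|: branch z i ch).

(** At the root all eight faces may be filled. The six sets start with 12 vertices, of which [D] are
    dropped; 84 + 3c - 7D < 78 remains to be shown, that is, 3c + 6 < 7D. *)
Lemma octa_sel_tot q ch :
  (forall s, wf (ch s)) -> (exists s, filled (ch s)) ->
  7 * \sum_i (#|octa_sel false q ch i| + #|octa_sel true q ch i|)
    < 39 * (\sum_s tsize (ch s) + 2).
Proof.
move=> wfch [s0 fs0].
have totO : \sum_i (#|octa_sel false q ch i| + #|octa_sel true q ch i|)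
    + (\sum_j droppable false j ch + \sum_j droppable true j ch)
    <= \sum_j (#|branch false j ch| + #|branch true j ch|) + 12.
  have -> : 12 = \sum_(i < 3) 4 by rewrite sum_nat_const card_ord.
  rewrite -!big_split /=; apply: leq_sum => i _.
  have le_z z : #|octa_sel z q ch i| + droppable z i ch <= #|branch z i ch| + 2.
    rewrite /octa_sel; case: (droppable _ _ _).
      by rewrite set0U cardsU1; case: (_ \notin _) => /=; lia.
    by rewrite !cardsU1; do 2!case: (_ \notin _) => /=; lia.
  by have := le_z true; have := le_z false; lia.
set A := [set s | filled (ch s)].
(* The complement of [s] lists the colours whose corner on the face is the vertex of [q false]. *)
set A' := [set ~: s | s in A].
have cardA' : #|A'| = #|A| by rewrite card_imset //; apply: (can_inj (@setCK _)).
have drop_old : \sum_j droppable true j ch = #|cover A'|.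
  rewrite -sum1_card [RHS]big_mkcond; apply: eq_bigr => j _.
  suff -> : droppable true j ch = (j \in cover A') by case: (j \in _).
  apply/existsP/bigcupP => [[s /andP[/= js fs]]|[_ /imsetP[s + ->]]].
    by exists (~: s); rewrite ?inE // imset_f // inE.
  by rewrite !inE => fs js; exists s; rewrite /= js.
(* Each corner of one filled face is dropped from one of the six sets. This is where the existence
   of a filled face enters. *)
have D3 : 3 <= #|cover A| + #|cover A'|.
  apply: (@leq_trans (#|s0| + #|~: s0|)); first by rewrite cardsC card_ord.
  have s0A : s0 \in A by rewrite inE.
  have s0A' : ~: s0 \in A' by apply: imset_f.
  apply: leq_add; apply: subset_leq_card; first exact: bigcup_sup s0A.
  exact: bigcup_sup s0A'.
have card_fam : 3 * \sum_s filled (ch s) + 6 <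
    7 * (\sum_j droppable false j ch + \sum_j droppable true j ch).
  rewrite sum_filled droppable_new drop_old -/A.
  have leA : #|A| <= 2 ^ #|cover A| := card_family_le A.
  have leA' : #|A| <= 2 ^ #|cover A'| by rewrite -cardA' card_family_le.
  have : #|cover A| <= 3 by have := max_card (mem (cover A)); rewrite card_ord.
  have : #|cover A'| <= 3 by have := max_card (mem (cover A')); rewrite card_ord.
  move: D3 leA leA'; move: #|A| #|cover A| #|cover A'|.
  by move=> c [|[|[|[|d]]]] [|[|[|[|d']]]] //=; lia.
have sumtot : 7 * \sum_s tot (ch s) <= 39 * \sum_s tsize (ch s) + 3 * \sum_s filled (ch s).
  by rewrite !big_distrr -big_split /=; apply: leq_sum => s _; apply: tot_le.
have := branch_tot ch; move: totO card_fam sumtot.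
move: (\sum_s tot _) (\sum_s filled _) (\sum_s tsize _).
move: (\sum_j _) (\sum_j _) (\sum_j _) (\sum_j _) => *.
lia.
Qed.

End OctahedronTrees.

(** * Independence and domination of the six sets *)

Section Selection.
Variable G : sgraph.
Implicit Types (x p : 'I_3 -> G) (q : bool -> 'I_3 -> G) (s : {set 'I_3}).
Implicit Types (t : otree G) (ch : {set 'I_3} -> otree G) (u v w : G) (A B : {set G}).

Definition dominated A v := (v \in A) || [exists u in A, adj v u].

Lemma dominated_adj A u v : u \in A -> adj v u -> dominated A v.
Proof. by move=> uA uv; apply/orP; right; apply/exists_inP; exists u. Qed.

Lemma dominatedS A B v : A \subset B -> dominated A v -> dominated B v.
Proof.
move=> /subsetP sAB /orP[/sAB vB|/exists_inP[u /sAB uB vu]].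
  by rewrite /dominated vB.
exact: dominated_adj uB vu.
Qed.

Lemma independentP A :
  reflect (forall u v, u \in A -> v \in A -> ~~ adj u v) (independent A).
Proof.
apply: (iffP forall_inP) => [ind u v uA vA|ind u uA].
  by have /forall_inP := ind u uA; apply.
by apply/forall_inP => v; apply: ind.
Qed.

Lemma independentU1 A w :
  independent A -> (forall v, v \in A -> ~~ adj w v) -> independent (w |: A).
Proof.
move=> /independentP indA wA; apply/independentP => u v.
rewrite !inE => /predU1P[->|uA] /predU1P[->|vA]; last exact: indA.
- by rewrite adj_irrefl.
- exact: wA.
- by rewrite adj_sym wA.
Qed.

(** Edges between corners stay unconstrained: what matters is the full neighbourhood of each inner
    vertex. *)
Definition tree_in x t : Prop :=
  [/\ forall v, occ x v + tocc t v <= 1,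
      forall u v, 0 < tocc t v -> adj u v -> [set u; v] \in tedges x t &
      forall u v, [set u; v] \in tedges x t -> adj u v].

Definition octa_in q ch : Prop :=
  [/\ forall v, occ (q false) v + occ (q true) v + \sum_s tocc (ch s) v <= 1,
      forall s, tree_in (corner q s) (ch s) &
      forall z i, ~~ adj (q z i) (q (~~ z) i)].

Lemma octa_inI x p ch :
  (forall v, occ x v + occ p v + \sum_s tocc (ch s) v <= 1) ->
  (forall u v, 0 < occ p v + \sum_s tocc (ch s) v -> adj u v ->
    [set u; v] \in tri_edges3 x :|: (octa_edges x p
      :|: \bigcup_s tedges (corner (octa x p) s) (ch s))) ->
  (forall u v, [set u; v] \in \bigcup_s tedges (corner (octa x p) s) (ch s) -> adj u v) ->
  octa_in (octa x p) ch.
Proof.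
move=> dis adjE Eadj.
have tri_occ e v : e \in tri_edges3 x -> v \in e -> 0 < occ x v.
  case/imsetP => -[i j] _ -> /=; rewrite !inE.
  by case/orP => /eqP ->; apply: occ_id_gt0.
have octa_occ e v : e \in octa_edges x p -> v \in e -> 0 < occ x v + occ p v.
  case/octa_edgesP => i [j [b [_ ->]]]; rewrite !inE => /orP[] /eqP ->.
    by rewrite addn_gt0 (occ_id_gt0 p) orbT.
  by case: b => /=; rewrite addn_gt0 occ_id_gt0 ?orbT.
(* An edge of the outer triangle or of the octahedron cannot join opposite vertices, since all six
   are distinct; an edge inside a subface has an inner end. *)
have xp_nadj i : ~~ adj (x i) (p i).
  apply/negP => /adjE; rewrite addn_gt0 occ_id_gt0 => /(_ isT).
  case/setUP => [/tri_occ/(_ (set22 _ _))|/setUP[]].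
  - by have := dis (p i); have := occ_id_gt0 p i; lia.
  - case/octa_edgesP => k [l [b [kl eqe]]].
    have injp : injective p by apply: occ_le1_inj => v; have := dis v; lia.
    have injx : injective x by apply: occ_le1_inj => v; have := dis v; lia.
    have xp j l' : x j != p l'.
      apply/eqP => eqxp; have := dis (x j).
      by have := occ_id_gt0 x j; have := occ_id_gt0 p l'; rewrite -eqxp; lia.
    have : x i \in [set p k; octa x p b l] by rewrite -eqe set21.
    have : p i \in [set p k; octa x p b l] by rewrite -eqe set22.
    rewrite !inE (negPf (xp _ _)) /=; case: b {eqe} => /=.
      by rewrite (negPf (xp _ _)).
    rewrite (inj_eq injp) [p i == _]eq_sym (negPf (xp _ _)) orbF (inj_eq injx).
    by move=> /eqP ik /eqP il; rewrite -ik -il eqxx in kl.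
  - case/bigcupP => s _ /tedges_inner[v]; rewrite !inE => vxp.
    have := dis v; rewrite (bigD1 s) //=.
    by case/orP: vxp => /eqP ->; [have := occ_id_gt0 x i|have := occ_id_gt0 p i]; lia.
split=> // [s|[] i]; last 2 first.
- by rewrite adj_sym.
- exact: xp_nadj.
split=> [v|u v tv uv|u v uvE].
- have := dis v; have /= := occ_corner_le (octa x p) s v.
  by rewrite (bigD1 s) //=; lia.
- have v0 : 0 < \sum_s tocc (ch s) v by rewrite (bigD1 s) //= addn_gt0 tv.
  have := adjE u v; rewrite addn_gt0 v0 orbT => /(_ isT uv).
  have dv := dis v; case/setUP => [/tri_occ/(_ (set22 _ _))|/setUP[|]].
  + by move: dv v0; set S := \sum_s _; lia.
  + move/octa_occ/(_ (set22 _ _)).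
    by move: dv v0; set S := \sum_s _; lia.
  + case/bigcupP => s' _ uvE; have [<- //|ss'] := eqVneq s' s.
    have := tedges_support uvE (set22 _ _).
    have /= := occ_corner_le (octa x p) s' v.
    by move: dv; rewrite (bigD1 s) //= (bigD1 s') //=; lia.
- by apply: Eadj; apply/bigcupP; exists s.
Qed.

Lemma tree_in_Node x p ch : tree_in x (Node p ch) -> octa_in (octa x p) ch.
Proof.
case=> /= dis adjE Eadj; apply: octa_inI => [v|u v v0 uv|u v uvE].
- by rewrite -addnA; apply: dis.
- by apply/setUP; right; apply: adjE.
- by apply: Eadj; apply/setUP; right.
Qed.

(** With [z] false the filling may rely on the corner [x i] for domination but must avoid its
    neighbours. With [z] true it dominates its interior alone and, if nonempty, also [x i]; this
    permits omitting that corner. *)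
Definition sel_spec x t z i : Prop :=
  [/\ forall v, v \in sel z t i -> 0 < tocc t v,
      independent (sel z t i),
      ~~ z -> forall v, v \in sel z t i -> ~~ adj (x i) v,
      forall v, 0 < tocc t v -> dominated (sel z t i) v \/ ~~ z /\ adj v (x i) &
      z -> filled t -> dominated (sel z t i) (x i)].

(** Different subfaces touch only in vertices of the octahedron, so independence is local. A filled
    face at [q (~~ z) j] has the type that dominates this vertex; without such a face, no selected
    inner vertex is adjacent to it. *)
Lemma branchP q ch z j :
  octa_in q ch -> (forall s z i, sel_spec (corner q s) (ch s) z i) ->
  [/\ independent (branch z j ch),
      forall v, v \in branch z j ch -> ~~ adj (q z j) v,
      forall s v, 0 < tocc (ch s) v -> dominated (branch z j ch) v \/ adj v (q z j),
      droppable z j ch -> dominated (branch z j ch) (q (~~ z) j) &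
      ~~ droppable z j ch -> forall v, v \in branch z j ch -> ~~ adj (q (~~ z) j) v].
Proof.
case=> dis tin _ spec.
have sub_branch s : sel (z (+) (j \in s)) (ch s) j \subset branch z j ch.
  exact: (bigcup_sup s).
have q_outer s b i : tocc (ch s) (q b i) = 0.
  have := dis (q b i); rewrite (bigD1 s) //=; have := occ_id_gt0 (q b) i.
  by case: b; lia.
have q_inj b b' i k : q b i = q b' k -> b = b' /\ i = k.
  move=> eqq; have eqb : b = b'.
    have := dis (q b i); have := occ_id_gt0 (q b) i; have := occ_id_gt0 (q b') k.
    by rewrite -eqq; case: b b' {eqq} => -[] //; lia.
  split=> //; rewrite -eqb in eqq; move: i k eqq; apply: occ_le1_inj => v.
  by have := dis v; case: b {eqb}; lia.
have sep s v u : 0 < tocc (ch s) v -> adj u v ->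
    0 < tocc (ch s) u \/ exists k, u = corner q s k.
  have [_ adjE _] := tin s; move=> v0 /(adjE _ _ v0) uvE.
  have := tedges_support uvE (set21 u v); rewrite addn_gt0.
  by case/orP => [/occ_gt0|]; [right|left].
(* The face [s] has a single corner of colour [j]. *)
have flag s v b : 0 < tocc (ch s) v -> adj (q b j) v -> b = (j \in s).
  move=> v0 /(sep _ _ _ v0)[|[k]]; first by rewrite q_outer.
  by case/q_inj => -> ->.
split.
- apply/independentP => u v /bigcupP[s _ us] /bigcupP[s' _ vs'].
  have [us0 /independentP ind _ _ _] := spec s (z (+) (j \in s)) j.
  have [vs0 _ _ _ _] := spec s' (z (+) (j \in s')) j.
  have [eqs|ss'] := eqVneq s s'; first by subst s'; apply: ind.
  apply/negP => /(sep _ _ _ (vs0 _ vs')) [u'|[k eqk]].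
    have := dis u; rewrite (bigD1 s) //= (bigD1 s') 1?eq_sym //=.
    by have := us0 _ us; lia.
  by have := us0 _ us; rewrite eqk q_outer.
- move=> v /bigcupP[s _ vs]; have [vs0 _ nadj _ _] := spec s (z (+) (j \in s)) j.
  apply/negP => qv; have eqz := flag _ _ _ (vs0 _ vs) qv.
  have := nadj _ v vs; rewrite /corner -eqz addbb => /(_ isT).
  by rewrite qv.
- move=> s v v0; have [_ _ _ dom _] := spec s (z (+) (j \in s)) j.
  case: (dom v v0) => [/(dominatedS (sub_branch s))|]; first by left.
  by rewrite negb_add /corner => -[/eqP <-]; right.
- case/existsP => s /andP[zs fs]; have [_ _ _ _ dom] := spec s (z (+) (j \in s)) j.
  have := dom zs fs; rewrite /corner; have -> : (j \in s) = ~~ z.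
    by move: zs; case: z {sub_branch dom} => /=; case: (j \in s).
  by move=> d; apply: dominatedS d; have := sub_branch s; case: z zs {sub_branch dom};
    case: (j \in s).
- rewrite negb_exists => /forallP nodrop v /bigcupP[s _ vs].
  have [vs0 _ _ _ _] := spec s (z (+) (j \in s)) j.
  apply/negP => qv; have eqz := flag _ _ _ (vs0 _ vs) qv.
  have := nodrop s; rewrite -eqz addbN addbb /=.
  by move: (vs0 _ vs); case: (ch s).
Qed.

Lemma ordS3_neq (i : 'I_3) : ordS i != i.
Proof. by rewrite -val_eqE /=; case: i => -[|[|[|]]]. Qed.

(** Induction on [t]. With [z] true, [p (ordS i)] dominates the other new vertices and [x i]. With
    [z] false, [x i] dominates the new vertices except [p i], which is selected or else dominated
    from a filled subface. *)
Lemma sel_specP x t z i : tree_in x t -> sel_spec x t z i.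
Proof.
elim: t x z i => [|p ch IH] x z i tin.
  split=> //= [v||_ v]; rewrite ?inE //.
  by apply/independentP => u v; rewrite inE.
have oin := tree_in_Node tin.
have spec s z' i' : sel_spec (corner (octa x p) s) (ch s) z' i'.
  by apply: IH; case: oin.
have [_ _ Eadj] := tin.
have padj k l b : k != l -> adj (p k) (octa x p b l).
  by move=> kl; apply: Eadj => /=; apply/setUP; left; apply/octa_edgesP; exists k, l, b.
have inner z' j v : v \in branch z' j ch -> 0 < tocc (Node p ch) v.
  case/bigcupP => s _ vs; have [vs0 _ _ _ _] := spec s (z' (+) (j \in s)) j.
  by rewrite /= (bigD1 s) //=; have := vs0 _ vs; lia.
have innerp k : 0 < tocc (Node p ch) (p k) by rewrite /= addn_gt0 occ_id_gt0.
have innerE v : 0 < tocc (Node p ch) v ->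
    (exists k, v = p k) \/ exists s, 0 < tocc (ch s) v.
  rewrite /= addn_gt0 => /orP[/occ_gt0|]; first by left.
  rewrite lt0n sum_nat_eq0 negb_forall => /existsP[s].
  by rewrite /= -lt0n; right; exists s.
rewrite /sel_spec sel_Node; case: z.
  set j := ordS i; have [ind nadj dom _ _] := branchP true j oin spec.
  have pj : p j \in p j |: branch true j ch by rewrite setU11.
  split=> // [v||v|_ _].
  - by rewrite in_setU1 => /predU1P[->|/inner].
  - exact: independentU1.
  - case/innerE => [[k ->]|[s v0]]; left.
      have [->|kj] := eqVneq k j; first by rewrite /dominated pj.
      exact: dominated_adj pj (padj k j true kj).
    have [d|vp] := dom _ _ v0; last exact: dominated_adj pj vp.
    by apply: dominatedS d; apply: subsetUr.
  - apply: dominated_adj pj _; rewrite adj_sym.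
    exact: (padj j i false (ordS3_neq i)).
have [ind nadj dom dropped kept] := branchP false i oin spec.
set A := _ :|: _.
have subA : branch false i ch \subset A by apply: subsetUr.
split=> // [v|||v].
- case/setUP => [|/inner //]; case: ifP => _; rewrite inE // => /eqP ->.
  exact: innerp.
- rewrite /A; case: ifPn => [_|nd]; first by rewrite set0U.
  exact: independentU1 (kept nd).
- move=> _ v /setUP[|/nadj //]; case: ifP => _; rewrite inE // => /eqP ->.
  by case: oin => _ _ /(_ false i).
- case/innerE => [[k ->]|[s v0]].
    have [->|ki] := eqVneq k i; last by right; split=> //; apply: (padj k i false).
    left; rewrite /A; case: ifPn => [dr|_]; first by rewrite set0U; apply: dropped.
    by rewrite /dominated setU11.
  have [d|vx] := dom _ _ v0; last by right.
  by left; apply: dominatedS d.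
Qed.

Lemma octa_sel_ids q ch z i :
  octa_in q ch -> (forall b b' k l, k != l -> adj (q b k) (q b' l)) ->
  (forall v, 0 < occ (q false) v + occ (q true) v + \sum_s tocc (ch s) v) ->
  independent (octa_sel z q ch i) && dominating (octa_sel z q ch i).
Proof.
move=> oin qadj all_v.
have spec s z' i' : sel_spec (corner q s) (ch s) z' i'.
  by apply: sel_specP; case: oin.
have [ind nadj dom dropped kept] := branchP z i oin spec.
rewrite /octa_sel; set A := _ :|: branch z i ch.
have subA : branch z i ch \subset q z i |: A.
  by apply: subset_trans (subsetUr _ _); apply: subsetUr.
have qA : q z i \in q z i |: A by rewrite setU11.
apply/andP; split.
  apply: independentU1.
    rewrite /A; case: ifPn => [_|nd]; first by rewrite set0U.
    exact: independentU1 (kept nd).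
  move=> v /setUP[|/nadj //]; case: ifP => _; rewrite inE // => /eqP ->.
  by case: oin => _ _; apply.
apply/forallP => v; rewrite -/(dominated _ _).
have qdom b k : dominated (q z i |: A) (q b k).
  have [->|ki] := eqVneq k i; last exact: dominated_adj qA (qadj _ _ _ _ ki).
  have [->|bz] := eqVneq b z; first by rewrite /dominated qA.
  have -> : b = ~~ z by move: bz; case: (b); case: (z).
  rewrite /A; case: ifPn => [dr|_].
    by apply: dominatedS (dropped dr); rewrite set0U subsetUr.
  by rewrite /dominated !inE eqxx orbT.
have := all_v v; rewrite addn_gt0 addn_gt0 -orbA.
case/or3P => [/occ_gt0[k ->]|/occ_gt0[k ->]|]; [exact: qdom|exact: qdom|].
rewrite lt0n sum_nat_eq0 negb_forall => /existsP[s]; rewrite /= -lt0n => v0.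
have [d|vq] := dom _ _ v0; last exact: dominated_adj qA vq.
exact: dominatedS d.
Qed.

(** * The root octahedron of the graph *)

Lemma set2_edges u v : ([set u; v] \in edges G) = adj u v.
Proof.
apply/imsetP/idP => [[[a b]]|uv]; last by exists (u, v); rewrite ?inE.
rewrite inE /= => ab eqe.
have : u \in [set a; b] by rewrite -eqe set21.
have : v \in [set a; b] by rewrite -eqe set22.
have : a \in [set u; v] by rewrite eqe set21.
have : b \in [set u; v] by rewrite eqe set22.
rewrite !inE => bE aE /orP[] /eqP ev /orP[] /eqP eu; subst u v => //.
- by move: bE; rewrite orbb => /eqP eb; rewrite eb in ab *.
- by rewrite adj_sym.
- by move: aE; rewrite orbb => /eqP eb; rewrite eb in ab *.
Qed.

Lemma RET_octa_in :
  recursive_Eulerian_triangulation G -> 9 <= #|G| ->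
  exists x p ch,
    [/\ octa_in (octa x p) ch,
        forall b b' k l, k != l -> adj (octa x p b k) (octa x p b' l),
        forall v, occ x v + occ p v + \sum_s tocc (ch s) v = 1,
        forall s, wf (ch s) & exists s, filled (ch s)].
Proof.
case=> F /RET_otree[x [t1 [t2 [eqV eqE _ wf1 wf2]]]] hn.
(* The two sides are interchangeable, and two empty trees would leave only three vertices. *)
wlog [p [ch et1]] : t1 t2 eqV eqE wf1 wf2 / exists p ch, t1 = Node p ch.
  move=> wl; case: t1 eqV eqE wf1 => [|p ch] eqV eqE wf1; last first.
    by apply: (wl (Node p ch) t2) => //; exists p, ch.
  case: t2 eqV eqE wf2 => [|p ch] eqV eqE wf2; last first.
    apply: (wl (Node p ch) (Hole G)) => //; last by exists p, ch.
      by move=> v; rewrite -eqV addnAC.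
    by rewrite eqE setUAC.
  suff : #|G| <= 3 by move=> n3; have := leq_trans hn n3.
  rewrite -(card_ord 3) -cardsT; apply: leq_trans (leq_imset_card x _).
  apply: subset_leq_card; apply/subsetP => v vT.
  have : 0 < occ x v by move: (eqV v); rewrite vT /= !addn0 => ->.
  by case/occ_gt0 => i ->; apply: imset_f.
(* The initial triangle becomes the face [set0] of the root octahedron, whose free slot receives the
   second tree. *)
subst t1; pose ch' := upd ch set0 t2.
have [/= ch0 wfch] := wf1.
have occ_ch' v : \sum_s tocc (ch' s) v = \sum_s tocc (ch s) v + tocc t2 v.
  rewrite -[LHS]addn0; apply: (@sum_upd _ (fun _ t => tocc t v)) => //=.
  by move: ch0; case: (ch set0) => //= _; rewrite !addn0.
have occ1 v : occ x v + occ p v + \sum_s tocc (ch' s) v = 1.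
  by have := eqV v; rewrite in_setT /= occ_ch' !addnA.
have edges_ch' : edges G = tri_edges3 x :|: (octa_edges x p
    :|: \bigcup_s tedges (corner (octa x p) s) (ch' s)).
  rewrite eqE /= -!setUA; congr (_ :|: (_ :|: _)).
  rewrite (bigD1 set0) //= [in RHS](bigD1 set0) //= /ch' {1}/upd eqxx.
  have -> : tedges (corner (octa x p) set0) (ch set0) = set0.
    by move: ch0; case: (ch set0).
  rewrite set0U setUC; congr (_ :|: _).
    by apply: eq_tedges => i; rewrite /corner inE.
  by apply: eq_bigr => s /negPf ns; rewrite /upd ns.
exists x, p, ch'; split=> //.
- apply: octa_inI => [v|u v _ uv|u v uvE]; first by rewrite occ1.
    by rewrite -edges_ch' set2_edges.
  by rewrite -set2_edges edges_ch' !in_setU uvE !orbT.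
- have oadj k l b : k != l -> adj (p k) (octa x p b l).
    move=> kl; rewrite -set2_edges edges_ch'; apply/setUP; right; apply/setUP; left.
    by apply/octa_edgesP; exists k, l, b.
  move=> [] b' k l kl; first exact: oadj.
  case: b'; first by rewrite adj_sym (oadj l k false) // eq_sym.
  rewrite -set2_edges edges_ch'; apply/setUP; left.
  by apply/imsetP; exists (k, l); rewrite ?inE.
- by move=> s; rewrite /ch' /upd; case: ifP => _; [exact: wf2|exact: wfch].
(* Without a filled face only the six vertices of the octahedron remain. *)
- apply/existsP; apply: contraLR hn; rewrite negb_exists -ltnNge => /forallP nf.
  have : \sum_v (occ x v + occ p v + \sum_s tocc (ch' s) v) = #|G|.
    by rewrite (eq_bigr (fun=> 1)) ?sum1_card // => v _; rewrite occ1.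
  move=> <-; rewrite (eq_bigr (fun v => occ x v + occ p v)).
    by rewrite big_split /= !sum_occ.
  move=> v _; rewrite big1 ?addn0 // => s _.
  by move: (nf s); case: (ch' s).
Qed.

End Selection.

(** * Averaging over the six sets *)

Theorem theorem12 (G : sgraph) (hG : recursive_Eulerian_triangulation G)
    (hn : (9 <= #|G|)%N) :
  ((indep_dom_number G)%:R < 13 * #|G|%:R / 42 :> rat)%R.
Proof.
have [x [p [ch [oin qadj occ1 wfch some_filled]]]] := RET_octa_in hG hn.
(* A third of the order: two triangles at the root and one for each node. *)
pose n' := \sum_s tsize (ch s) + 2.
have cardG : #|G| = 3 * n'.
  have <- : \sum_v (occ x v + occ p v + \sum_s tocc (ch s) v) = #|G|.
    by rewrite (eq_bigr (fun=> 1)) ?sum1_card // => v _; rewrite occ1.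
  rewrite !big_split /= !sum_occ exchange_big /= mulnDr addnC big_distrr /=.
  by congr (_ + _); apply: eq_bigr => s _; apply: sum_tocc.
(* The total is below 39n'/7, which is six times 13n'/14, and n' = n/3 turns 14 into 42. *)
have [z [i small]] : exists z i, 14 * #|octa_sel z (octa x p) ch i| < 13 * n'.
  suff /existsP[[z i] /= small] :
      [exists k : bool * 'I_3, 14 * #|octa_sel k.1 (octa x p) ch k.2| < 13 * n'].
    by exists z, i.
  apply: contraT; rewrite negb_exists => /forallP large.
  have := octa_sel_tot (octa x p) wfch some_filled.
  rewrite ltnNge -/n' => /negP[]; rewrite -(leq_pmul2l (isT : 0 < 2)) [X in _ <= X]mulnA big_distrr /=.
  have -> : 2 * (39 * n') = \sum_(i < 3) (26 * n') by rewrite sum_nat_const card_ord; lia.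
  apply: leq_sum => i _; have := large (false, i); have := large (true, i).
  by rewrite -!leqNgt /=; lia.
have le_iota : indep_dom_number G <= #|octa_sel z (octa x p) ch i|.
  rewrite /indep_dom_number; case: ex_minnP => m _; apply.
  apply/existsP; exists (octa_sel z (octa x p) ch i).
  rewrite eqxx andbT; apply: octa_sel_ids => // v.
  by rewrite occ1.
rewrite Num.Theory.ltr_pdivlMr // -!GRing.natrM Num.Theory.ltr_nat.
by rewrite cardG; lia.
Qed.
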